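(* Let $G$ be a bipartite graph with vertex classes $L$ and $U$, and let $p$ be a positive real number with $|L|^{-1} \leq p \leq |L|^{-1}|U|^{-1}E(L,U)$. Then for every $R \subseteq U$, \[\left(E(L,R) - p|L|\,|R|\right)^2 \leq |R|\left(\sum_{u \in U}\sum_{\substack{v_1, v_2 \in L\\ v_1 \neq v_2}}\left(\mathbf{1}_{v_1 \sim u}\mathbf{1}_{v_2 \sim u} - p^2\right) + E(L,U)\right),\] where the inner sum is over ordered pairs of distinct vertices.
   Context: For vertices $u,v$ of a graph, $u \sim v$ means $\{u,v\}$ is an edge, and $\mathbf{1}_{v\sim u}$ is $1$ if $v \sim u$ and $0$ otherwise. For vertex subsets $A, B$, $E(A,B) = \#\{(u,v) \in A \times B : u \sim v\}$. *)

(* Defs.v *)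
From mathcomp Require Import all_boot all_order all_algebra.
From mathcomp Require Import reals.

Set Implicit Arguments.
Unset Strict Implicit.
Unset Printing Implicit Defensive.

Definition simple_graph (V : finType) (adj : rel V) : Prop :=
  symmetric adj /\ irreflexive adj.

(* [partition] from finset is not used because it would force both classes
   to be nonempty. *)
Definition bipartite (V : finType) (adj : rel V) (L U : {set V}) : Prop :=
  [/\ simple_graph adj,
      L :|: U = [set: V],
      [disjoint L & U] &
      forall x y, adj x y ->
        (x \in L /\ y \in U) \/ (x \in U /\ y \in L)].

(* Ordered pairs: an edge with both ends in A :&: B is counted twice. *)
Definition edge_count (V : finType) (adj : rel V) (A B : {set V}) : nat :=
  #|[set uv : V * V | [&& uv.1 \in A, uv.2 \in B & adj uv.1 uv.2]]|.

(* Main.v *)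
(** Let [d u] be the number of neighbours of [u] in [L].  The bracket on the
    right equals [\sum_(u in U) (d u ^+ 2 - p ^+ 2 * #|L| * (#|L| - 1))], and
    [p * #|L| * #|U| <= E(L, U)] makes this at least
    [\sum_(u in U) (d u - p * #|L|) ^+ 2].  Discarding the terms outside [R],
    Cauchy-Schwarz over [R] gives the claim. *)

Require Import Defs.
From mathcomp Require Import all_boot all_order all_algebra.
From mathcomp Require Import reals ring lra.
Import Order.TTheory GRing.Theory Num.Theory.
Local Open Scope ring_scope.

(** Cauchy-Schwarz against the constant 1: both sides become double sums over [A], compared termwise
    by [f i * f j <= (f i ^+ 2 + f j ^+ 2) / 2]. *)
Lemma sqr_sum_le_card (K : realFieldType) (I : finType) (A : {set I})
    (f : I -> K) :
  (\sum_(i in A) f i) ^+ 2 <= #|A|%:R * \sum_(i in A) f i ^+ 2.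
Proof.
have -> : (\sum_(i in A) f i) ^+ 2 = \sum_(i in A) \sum_(j in A) f i * f j.
  by rewrite expr2 mulr_suml; apply: eq_bigr => i _; rewrite mulr_sumr.
have -> : #|A|%:R * \sum_(i in A) f i ^+ 2
    = \sum_(i in A) \sum_(j in A) (f i ^+ 2 + f j ^+ 2) / 2.
  under [RHS]eq_bigr do rewrite -mulr_suml big_split /= sumr_const.
  rewrite -mulr_suml big_split /= sumr_const -sumrMnl mulr_natl -sumrMnl.
  by field.
apply: ler_sum => i _; apply: ler_sum => j _.
by have := sqr_ge0 (f i - f j); lra.
Qed.

(** The outer sum runs over [B], so that the inner sums are degrees into [A]. *)
Lemma edge_countE (K : pzSemiRingType) (V : finType) (adj : rel V)
    (A B : {set V}) :
  (edge_count adj A B)%:R = \sum_(u in B) \sum_(v in A) (adj v u)%:R :> K.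
Proof.
rewrite exchange_big pair_big /= /edge_count -sum1_card natr_sum.
under eq_bigl do rewrite inE andbA.
by rewrite big_mkcondr /=; apply: eq_bigr => uv _; case: adj.
Qed.

(** The full double sum of products is a square; its diagonal is [\sum_(i in A) (a i)%:R] because 0
    and 1 are idempotent. The factor [#|A|%:R - 1] is subtracted in the ring, hence not
    truncated. *)
Lemma sum_offdiag (K : comPzRingType) (I : finType) (A : {set I})
    (a : I -> bool) (c : K) :
  \sum_(i in A) \sum_(j in A | i != j) ((a i)%:R * (a j)%:R - c)
  = (\sum_(i in A) (a i)%:R) ^+ 2 - \sum_(i in A) (a i)%:R
    - #|A|%:R * (#|A|%:R - 1) * c.
Proof.
have row i : i \in A ->
    \sum_(j in A | i != j) ((a i)%:R * (a j)%:R - c)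
    = (a i)%:R * (\sum_(j in A) (a j)%:R) - (a i)%:R - (#|A|%:R - 1) * c.
  move=> iA.
  have full : \sum_(j in A) ((a i)%:R * (a j)%:R - c)
      = (a i)%:R * (\sum_(j in A) (a j)%:R) - #|A|%:R * c.
    by rewrite sumrB -mulr_sumr sumr_const -[c *+ _]mulr_natl.
  have diag : (a i)%:R * (a i)%:R = (a i)%:R :> K.
    by case: (a i); rewrite ?mulr1 ?mulr0.
  (* Split off the term [j = i] from the full row, then solve for the rest. *)
  rewrite (bigD1 i) //= diag in full.
  under eq_bigl do rewrite eq_sym.
  move: full => /(canRL (addKr _)) ->.
  ring.
rewrite (eq_bigr _ row) !sumrB -mulr_suml sumr_const -mulr_natl.
ring.
Qed.

Theorem theorem2p1 (K : realType) (V : finType) (adj : rel V) (L U : {set V})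
    (hG : bipartite adj L U) (p : K) (hp : 0 < p)
    (hp_lo : #|L|%:R^-1 <= p)
    (hp_hi : p <= #|L|%:R^-1 * #|U|%:R^-1 * (edge_count adj L U)%:R)
    (R : {set V}) (hR : R \subset U) :
  ((edge_count adj L R)%:R - p * #|L|%:R * #|R|%:R) ^+ 2
  <= #|R|%:R *
     (\sum_(u in U) \sum_(v1 in L) \sum_(v2 in L | v1 != v2)
        ((adj v1 u)%:R * (adj v2 u)%:R - p ^+ 2)
      + (edge_count adj L U)%:R).
Proof.
have density : p * #|L|%:R * #|U|%:R <= (edge_count adj L U)%:R.
  (* If a class is empty the left side is 0; otherwise the denominators of [hp_hi] can be
     cleared. *)
  have [L0|L0] := eqVneq (#|L|%:R : K) 0; first by rewrite L0 mulr0 mul0r.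
  have [U0|U0] := eqVneq (#|U|%:R : K) 0; first by rewrite U0 mulr0.
  have LU_gt0 : 0 < (#|L|%:R * #|U|%:R : K).
    by rewrite lt_def mulf_neq0 // mulr_ge0.
  by rewrite -mulrA -ler_pdivlMr // mulrC invfM.
rewrite !edge_countE in density *.
pose d u : K := \sum_(v in L) (adj v u)%:R.
have -> : \sum_(u in R) d u - p * #|L|%:R * #|R|%:R
    = \sum_(u in R) (d u - p * #|L|%:R).
  by rewrite sumrB sumr_const mulr_natr.
apply: le_trans (sqr_sum_le_card _ _ _ _) _.
apply: ler_wpM2l; first exact: ler0n.
apply: (@le_trans _ _ (\sum_(u in U) (d u - p * #|L|%:R) ^+ 2)).
  rewrite [leRHS](big_setID R) /= (setIidPr hR) lerDl.
  by apply: sumr_ge0 => u _; apply: sqr_ge0.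
under [X in _ <= X + _]eq_bigr do rewrite sum_offdiag -/(d _).
(* The term [E(L, U)] is [\sum_(u in U) d u], which cancels the diagonal correction [- d u]. *)
rewrite -big_split /=.
have -> : \sum_(u in U) (d u - p * #|L|%:R) ^+ 2
    = \sum_(u in U) d u ^+ 2 - 2 * p * #|L|%:R * (\sum_(u in U) d u)
      + #|U|%:R * (p * #|L|%:R) ^+ 2.
  rewrite mulr_sumr -sumrB [#|U|%:R * _]mulr_natl -[_ *+ #|U|]sumr_const -big_split /=.
  by apply: eq_bigr => u _; ring.
have -> : \sum_(u in U)
      (d u ^+ 2 - d u - #|L|%:R * (#|L|%:R - 1) * p ^+ 2 + d u)
    = \sum_(u in U) d u ^+ 2 - #|U|%:R * (#|L|%:R * (#|L|%:R - 1) * p ^+ 2).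
  rewrite [#|U|%:R * _]mulr_natl -[_ *+ #|U|]sumr_const -sumrB.
  by apply: eq_bigr => u _; ring.
(* Right minus left is [2 * p * #|L| * (E(L, U) - p * #|L| * #|U|) + p ^+ 2 * #|L| * #|U|]: twice
   the gap in [main], plus [slack]. *)
have pL_ge0 : 0 <= p * #|L|%:R by rewrite mulr_ge0 ?ler0n ?ltW.
have main := ler_wpM2l pL_ge0 density.
have slack : 0 <= p * (p * #|L|%:R) * #|U|%:R by rewrite !mulr_ge0 ?ler0n ?ltW.
lra.
Qed.
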